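(* Let $(\mathbb{E},\circ,\bullet)$ be a Euclidean Jordan algebra of dimension $n$, let $m\ge1$ and $r\ge 0$ be integers. Then $\mathcal{K}_{\mathrm{NN},r}^{n,m}(\mathbb{E}_+)=\mathcal{C}_r^{n,m}(\mathbb{E}_+)^*$, and thus $\mathcal{K}_{\mathrm{NN},r}^{n,m}(\mathbb{E}_+)^*=\operatorname{cl}\mathcal{C}_r^{n,m}(\mathbb{E}_+)$.
   Context: A Euclidean Jordan algebra $(\mathbb{E},\circ,\bullet)$ is a finite-dimensional real vector space with a bilinear product $\circ$ such that $x\circ y=y\circ x$ and $x\circ((x\circ x)\circ y)=(x\circ x)\circ(x\circ y)$, having an identity element for $\circ$, together with a fixed inner product $\bullet$ satisfying $(x\circ y)\bullet z=x\bullet(y\circ z)$. Its symmetric cone is $\mathbb{E}_+=\{x\circ x\mid x\in\mathbb{E}\}$. $\mathbb{E}^{\otimes k}$ carries the inner product $\langle\cdot,\cdot\rangle$ induced by $\bullet$: $\langle x_1\otimes\cdots\otimes x_k,y_1\otimes\cdots\otimes y_k\rangle=\prod_i x_i\bullet y_i$; $\mathcal{S}^{n,k}(\mathbb{E})\subseteq\mathbb{E}^{\otimes k}$ is the subspace of symmetric tensors; $x^{\otimes k}=x\otimes\cdots\otimes x$; $\mathscr{S}$ is the symmetrization map (average over all permutations of the tensor factors). For a cone $\mathcal{K}$ in an inner product space (here $\mathcal{S}^{n,k}(\mathbb{E})$), $\mathcal{K}^*$ is its dual cone $\{x\mid\langle x,y\rangle\ge0\ \forall y\in\mathcal{K}\}$,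 and $\operatorname{cl}$ is closure. $\mathrm{SOS}^{n,2k}(\mathbb{E})=\operatorname{conv}\{\mathscr{S}(\mathcal{B}\otimes\mathcal{B})\mid\mathcal{B}\in\mathcal{S}^{n,k}(\mathbb{E})\}\subseteq\mathcal{S}^{n,2k}(\mathbb{E})$ and $\mathrm{MOM}^{n,2k}(\mathbb{E})=\mathrm{SOS}^{n,2k}(\mathbb{E})^*$ (dual in $\mathcal{S}^{n,2k}(\mathbb{E})$). For $\mathcal{A}\in\mathcal{S}^{n,m}(\mathbb{E})$, $\mathcal{A}^{(r)}$ is the unique element of $\mathcal{S}^{n,2(r+m)}(\mathbb{E})$ with $(x\bullet x)^r\langle\mathcal{A},(x\circ x)^{\otimes m}\rangle=\langle\mathcal{A}^{(r)},x^{\otimes2(r+m)}\rangle$ for all $x\in\mathbb{E}$, and $\mathcal{K}_{\mathrm{NN},r}^{n,m}(\mathbb{E}_+)=\{\mathcal{A}\in\mathcal{S}^{n,m}(\mathbb{E})\mid\mathcal{A}^{(r)}\in\mathrm{SOS}^{n,2(r+m)}(\mathbb{E})\}$. $\mathcal{C}^{(r)}:\mathcal{S}^{n,2(r+m)}(\mathbb{E})\to\mathcal{S}^{n,m}(\mathbb{E})$ is the adjoint of the linear map $\mathcal{A}\mapsto\mathcal{A}^{(r)}$, i.e. $\langle\mathcal{A},\mathcal{C}^{(r)}(\mathcal{X})\rangle=\langle\mathcal{A}^{(r)},\mathcal{X}\rangle$ for all $\mathcal{A},\mathcal{X}$, and $\mathcal{C}_r^{n,m}(\mathbb{E}_+)=\{\mathcal{C}^{(r)}(\mathcal{X})\mid\mathcal{X}\in\mathrm{MOM}^{n,2(r+m)}(\mathbb{E})\}$.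 *)

(* Defs.v *)
From HB Require Import structures.
From mathcomp Require Import all_boot all_order all_algebra all_fingroup.
From mathcomp Require Import all_classical all_reals all_analysis.

Set Implicit Arguments.
Unset Strict Implicit.
Unset Printing Implicit Defensive.

Import Order.TTheory GRing.Theory Num.Theory.
Import numFieldNormedType.Exports.

Local Open Scope classical_set_scope.
Local Open Scope ring_scope.

Record euclidean_jordan (R : realType) (E : vectType R) := EuclideanJordan {
  jmul : {bilinear E -> E -> E};
  jdot : {dot E for idfun};
  jmulC : forall x y, jmul x y = jmul y x;
  jmul_jordan : forall x y,
    jmul x (jmul (jmul x x) y) = jmul (jmul x x) (jmul x y);
  jmul_identity : exists e, forall x, jmul e x = x;
  jdot_mul : forall x y z, jdot (jmul x y) z = jdot x (jmul y z) }.

(* The convex hull: the intersection of all convex sets that contain A. *)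
Definition conv_hull (R : realType) (V : lmodType R) (A : set V) : set V :=
  smallest (@convex_set R V) A.

Section Tensors.
Context {R : realType} {E : vectType R}.

Notation n := (\dim {:E}).

Definition tbasis (i : 'I_n) : E := (vbasis {:E})`_i.

Definition tindex (k : nat) : finType := {ffun 'I_k -> 'I_n}.

(* The k-th tensor power of E, as the space of coordinate vectors in the basis
   tbasis (i 0) ⊗ ... ⊗ tbasis (i (k-1)), for i : tindex k.  Row vectors are
   used because they carry the vector space structure and the usual topology;
   the symmetric tensors are closed in it, so closures of sets of symmetric
   tensors may be taken in the whole space. *)
Definition tensor (k : nat) := 'rV[R]_#|tindex k|.

Definition tcoef k (A : tensor k) (i : tindex k) : R := A 0 (enum_rank i).

Definition tensor_of k (F : tindex k -> R) : tensor k :=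
  \row_j F (enum_val j).

Lemma tcoefE k (F : tindex k -> R) i : tcoef (tensor_of F) i = F i.
Proof. by rewrite /tcoef mxE enum_rankK. Qed.

Lemma tensorP k (A B : tensor k) : (forall i, tcoef A i = tcoef B i) -> A = B.
Proof.
by move=> AB; apply/rowP => j; have := AB (enum_val j); rewrite /tcoef enum_valK.
Qed.

Definition tpure k (x : 'I_k -> E) : tensor k :=
  tensor_of (fun i => \prod_s coord (vbasis {:E}) (i s) (x s)).

Definition tpow k (x : E) : tensor k := tpure (fun=> x).

Definition tmul k l (A : tensor k) (B : tensor l) : tensor (k + l)%N :=
  tensor_of (fun i => tcoef A [ffun s => i (lshift l s)] *
                      tcoef B [ffun s => i (rshift k s)]).

Definition tensor_perm k (s : 'S_k) (A : tensor k) : tensor k :=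
  tensor_of (fun i => tcoef A [ffun t => i (s t)]).

Definition symmetric_tensor k : set (tensor k) :=
  [set A | forall s : 'S_k, tensor_perm s A = A].

Definition symmetrize k (A : tensor k) : tensor k :=
  (k`!%:R)^-1 *: \sum_(s : 'S_k) tensor_perm s A.

(* The bilinear extension of the inner product from the basis tensors; see
   tdot_tpure for its values on pure tensors. *)
Definition tdot (dot : {dot E for idfun}) k (A B : tensor k) : R :=
  \sum_i \sum_j tcoef A i * tcoef B j *
    \prod_(s < k) dot (tbasis (i s)) (tbasis (j s)).

Lemma tdot_tpure (dot : {dot E for idfun}) k (x y : 'I_k -> E) :
  tdot dot (tpure x) (tpure y) = \prod_s dot (x s) (y s).
Proof.
have dotE u v : dot u v = \sum_(a < n) \sum_(b < n)
    coord (vbasis {:E}) a u * coord (vbasis {:E}) b v *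
    dot (tbasis a) (tbasis b).
  rewrite {1}(coord_vbasis (memvf u)) {1}(coord_vbasis (memvf v)).
  rewrite linear_sumlz; apply: eq_bigr => a _.
  rewrite linear_sumr; apply: eq_bigr => b _.
  by rewrite linearZl_LR linearZr_LR /= mulrA.
under [RHS]eq_bigr => s _ do rewrite dotE.
rewrite bigA_distr_bigA; apply: eq_bigr => i _.
rewrite bigA_distr_bigA; apply: eq_bigr => j _.
by rewrite !tcoefE !big_split.
Qed.

(* The dual cone inside the space of symmetric tensors. *)
Definition dual_cone (dot : {dot E for idfun}) k (K : set (tensor k)) :
    set (tensor k) :=
  [set A | symmetric_tensor A /\ forall B, K B -> 0 <= tdot dot A B].

Definition SOS k : set (tensor (k + k)%N) :=
  conv_hull [set symmetrize (tmul B B) | B in symmetric_tensor (k := k)].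

Definition MOM (dot : {dot E for idfun}) k : set (tensor (k + k)%N) :=
  dual_cone dot (@SOS k).

End Tensors.

Arguments tensor {R} E k.
Arguments symmetric_tensor {R E} k.
Arguments SOS {R} E k.
Arguments MOM {R E} dot k.

Section Hierarchies.
Context {R : realType} {E : vectType R} (J : euclidean_jordan E).

(* The map A |-> A^(r).  The symmetric tensor described exists and is unique,
   so that the default value 0 of xget plays no role. *)
Definition lift_tensor (r m : nat) (A : tensor E m) :
    tensor E ((r + m) + (r + m))%N :=
  xget 0 [set B | symmetric_tensor _ B /\
    forall x : E, jdot J x x ^+ r * tdot (jdot J) A (tpow m (jmul J x x)) =
      tdot (jdot J) B (tpow _ x)].

Definition K_NN (r m : nat) : set (tensor E m) :=
  [set A | symmetric_tensor m A /\ SOS E (r + m)%N (lift_tensor r A)].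

(* The adjoint C^(r) of A |-> A^(r), as a map to symmetric tensors; it exists
   and is unique on symmetric tensors. *)
Definition lift_adjoint (r m : nat) (X : tensor E ((r + m) + (r + m))%N) :
    tensor E m :=
  xget 0 [set C | symmetric_tensor m C /\
    forall A, symmetric_tensor m A ->
      tdot (jdot J) A C = tdot (jdot J) (lift_tensor r A) X].

Definition C_cone (r m : nat) : set (tensor E m) :=
  [set lift_adjoint X | X in MOM (jdot J) (r + m)%N].

End Hierarchies.

Arguments K_NN {R E} J r m.
Arguments C_cone {R E} J r m.

(* Main.v *)
Require Import Defs.
From HB Require Import structures.
From mathcomp Require Import all_boot all_order all_algebra all_fingroup.
From mathcomp Require Import all_classical all_reals all_analysis.
From mathcomp Require Import ring lra.
Import Order.TTheory GRing.Theory Num.Theory.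
Import numFieldNormedType.Exports.
Local Open Scope classical_set_scope.
Local Open Scope ring_scope.
Set Implicit Arguments.
Unset Strict Implicit.
Unset Printing Implicit Defensive.

(* The map A |-> A^(r) and the map C^(r) are adjoint, so the dual of the image
   C^(r)(MOM) consists of the A whose lift A^(r) lies in MOM* = SOS**, which is
   the closure of SOS by the bipolar theorem.  SOS is closed: it is the linear
   image of the closed cone of positive semidefinite Gram matrices with
   symmetric tensors as rows, and a sum of squares of forms <B_l, x^(⊗k)>
   vanishes identically only if every B_l does, so that the map is injective at
   0 on this cone.  The second equality is the bipolar theorem for C^(r)(MOM). *)

(** * Convex cones in row vector spaces: closures, linear images, separation *)

Definition convex_cone (R : numDomainType) (V : lmodType R) (K : set V) :=
  [/\ K 0, forall x y, K x -> K y -> K (x + y)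
    & forall a x, 0 <= a -> K x -> K (a *: x)].

Lemma sum_continuous (R : realType) (T : topologicalType) (V : normedModType R)
    (I : finType) (F : I -> T -> V) :
  (forall i, continuous (F i)) -> continuous (fun x => \sum_i F i x).
Proof.
by move=> Fc x; apply: (cvg_big (@add_continuous _)) => i _; exact: Fc.
Qed.

Lemma row_linear_continuous (R : realType) d (V : normedModType R)
  (f : {linear 'rV[R]_d -> V}) : continuous f.
Proof.
have -> : f = (fun x : 'rV[R]_d => \sum_i x 0 i *: f (delta_mx 0 i)) :> (_ -> _).
  by apply/funext => x; rewrite {1}[x]row_sum_delta linear_sum; apply: eq_bigr => i _;
    rewrite linearZ.
apply: sum_continuous => i x.
exact: (@cvgZr_tmp _ _ _ (nbhs x) _ _ _ _ (@coord_continuous _ _ _ 0 i x)).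
Qed.

Lemma closure_convex_cone (R : realType) (V : normedModType R) (K : set V) :
  convex_cone K -> convex_cone (closure K).
Proof.
move=> [K0 KD KZ].
(* Extension by continuity from [K] to its closure. It is applied to one summand at a time: first
   with [x] in [K], then with both points in the closure. *)
have clD (f : V -> V) : continuous f ->
    K `<=` f @^-1` closure K -> closure K `<=` f @^-1` closure K.
  move=> cf Kf x /(closureS Kf).
  by apply: preimage_closed x; [move=> y _; exact: cf|exact: closed_closure].
have KcD x y : K x -> closure K y -> closure K (x + y).
  move=> Kx; apply: (clD (fun y => x + y)).
    by move=> z; apply: cvgD; [exact: cvg_cst|exact: cvg_id].
  by move=> z Kz; apply: subset_closure; exact: KD.
split; first exact: subset_closure.
- move=> x y Kx Ky; rewrite addrC; move: x Kx; apply: (clD (fun x => y + x)).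
    by move=> z; apply: cvgD; [exact: cvg_cst|exact: cvg_id].
  by move=> z Kz; rewrite /preimage/= addrC; exact: KcD.
- move=> a x a0; move: x; apply: (clD (fun x => a *: x)).
    by move=> z; apply: (@cvgZl_tmp _ _ _ (nbhs z)); exact: cvg_id.
  by move=> z Kz; apply: subset_closure; exact: KZ.
Qed.

(** On the unit vectors of [K], a compact set, [|f x|] has a positive minimum c, so
    [c * |x| <= |f x|] on [K] by homogeneity. Points of [K] with image near [z] therefore stay
    bounded, and the image of a bounded closed part of [K] is compact, hence closed. *)
Lemma closed_cone_image (R : realType) d e (f : {linear 'rV[R]_d -> 'rV[R]_e})
    (K : set 'rV[R]_d) :
  closed K -> convex_cone K -> (forall x, K x -> f x = 0 -> x = 0) ->
  closed (f @` K).
Proof.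
move=> Kcl [K0 KD KZ] fK.
have normc (n : nat) (g : 'rV[R]_d -> 'rV[R]_n) : continuous g -> continuous (fun x => `|g x|).
  move=> cg x; apply: (@continuous_comp _ _ _ g (fun y => `|y|)); first exact: cg.
  exact: norm_continuous.
have [c c0 cP] : exists2 c, 0 < c & forall x, K x -> c * `|x| <= `|f x|.
  pose S := K `&` [set x | `|x| = 1].
  have [[s Ss]|S0] := pselect (S !=set0); last first.
    (* A cone with no unit vector is reduced to 0, so any constant works. *)
    exists 1 => // x Kx; have [->|x0] := eqVneq x 0; first by rewrite normr0 mulr0.
    exfalso; apply: S0; exists (`|x|^-1 *: x); split; first by apply: KZ; rewrite ?invr_ge0.
    by rewrite /= normrZ normfV normr_id mulVf// normr_eq0.
  have Sc : compact S.
    apply: bounded_closed_compact.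
      by exists 1; split => // M M1 x [_ /= ->]; exact: ltW.
    apply: closedI => //; apply: (@preimage_closed _ _ (fun x : 'rV[R]_d => `|x|) [set 1]).
      by move=> x _; exact: norm_continuous.
    exact: closed_eq.
  have [||y yS ymin] := @compact_EVT_min _ _ (fun x => `|f x|) S _ Sc.
  - by exists s.
  - by apply: continuous_subspaceT; apply: normc; exact: row_linear_continuous.
  have [Ky y1] := set_mem yS.
  exists `|f y|.
    rewrite normr_gt0; apply/eqP => fy0; have := fK _ Ky fy0 => y0.
    by move: y1; rewrite y0 /= normr0 => /eqP; rewrite eq_sym oner_eq0.
  move=> x Kx; have [->|x0] := eqVneq x 0; first by rewrite normr0 mulr0.
  have xp : 0 < `|x| by rewrite normr_gt0.
  rewrite -ler_pdivlMr // mulrC -[X in X * _]ger0_norm ?invr_ge0//.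
  rewrite -normrZ -linearZ; apply: ymin; apply/mem_set; split.
    by apply: KZ; rewrite ?invr_ge0.
  by rewrite /= normrZ normfV normr_id mulVf// gt_eqF.
move=> z clz.
(* If [f x] is within 1 of [z], then [c * |x| <= |f x| <= |z| + 1], which gives this radius. *)
pose B := K `&` [set x | `|x| <= (`|z| + 1) / c].
have Bc : compact (f @` B).
  apply: continuous_compact.
    by apply: continuous_subspaceT; exact: row_linear_continuous.
  apply: bounded_closed_compact.
    by exists ((`|z| + 1) / c); split => [|M MM x [_ /= xM]];
      [exact: num_real|exact: le_trans (ltW MM)].
  apply: closedI => //.
  apply: (@preimage_closed _ _ (fun x : 'rV[R]_d => `|x|) [set y | y <= (`|z| + 1) / c]).
    by move=> x _; exact: norm_continuous.
  exact: closed_le.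
suff : closure (f @` B) z.
  move=> /(compact_closed (@norm_hausdorff _ _) Bc)[x [Kx _] <-]; by exists x.
move=> U Uz.
have [|w [[x Kx <-] [Ux zx]]] := clz (U `&` ball z 1).
  by apply: filterI => //; exact: nbhsx_ballx.
exists (f x); split => //; exists x => //; split => //=.
rewrite ler_pdivlMr// mulrC; apply: le_trans (cP _ Kx) _.
move: zx; rewrite -ball_normE /= => zx.
rewrite -[f x](subrK z) addrC; apply: le_trans (ler_normD _ _) _.
by rewrite lerD2l distrC ltW.
Qed.

(* The witness is the difference between x and its Euclidean projection. *)
Lemma cone_separation (R : realType) d (K : set 'rV[R]_d) (x : 'rV[R]_d) :
  closed K -> convex_cone K -> ~ K x ->
  exists u : 'I_d -> R, (forall y, K y -> 0 <= \sum_i y 0 i * u i) /\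
    \sum_i x 0 i * u i < 0.
Proof.
move=> Kcl [K0 KD KZ] Kx.
pose q (y : 'rV[R]_d) : R := \sum_i (x 0 i - y 0 i) ^+ 2.
(* The norm on row vectors is the maximum norm, hence at most the Euclidean distance. *)
have qge y : `|x - y| ^+ 2 <= q y.
  have qy0 : 0 <= q y by apply: sumr_ge0 => i _; exact: sqr_ge0.
  rewrite -(@ler_sqrt _ (`|x - y| ^+ 2)) // sqrtr_sqr normr_id.
  rewrite [leLHS]/Num.norm /= mx_normrE; apply/bigmax_leP; split; first exact: sqrtr_ge0.
  move=> [i j] _; rewrite /= -sqrtr_sqr ler_sqrt // ord1 !mxE.
  by rewrite /q (bigD1 j) //= lerDl; apply: sumr_ge0 => k _; exact: sqr_ge0.
(* A point of norm above [M] has distance at least [1 + q 0] from [x]. The square of this is at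
   least [q 0], so 0, which lies in [K], does no worse, and minimizing over the compact set [B] is
   enough. *)
pose M := `|x| + (1 + q 0).
have q00 : 0 <= q 0 by apply: sumr_ge0 => i _; exact: sqr_ge0.
pose B := K `&` [set y | `|y| <= M].
have Bc : compact B.
  apply: bounded_closed_compact.
    by exists M; split => [|N MN y [_ /= yM]]; [exact: num_real|exact: le_trans (ltW MN)].
  apply: closedI => //.
  apply: (@preimage_closed _ _ (fun x : 'rV[R]_d => `|x|) [set y | y <= M]).
    by move=> y _; exact: norm_continuous.
  exact: closed_le.
have [||y0 y0B y0min] := @compact_EVT_min _ _ q B _ Bc.
- by exists 0; split => //=; rewrite normr0 /M !addr_ge0.
- apply: continuous_subspaceT; apply: (@sum_continuous R _ R^o) => i y.
  apply: (@continuous_comp _ _ _ (fun y : 'rV[R]_d => y 0 i)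
                                 (fun t => (x 0 i - t) ^+ 2)).
    exact: coord_continuous.
  apply: (@continuous_comp _ _ _ (fun t => x 0 i - t) (fun t => t ^+ 2)).
    by apply: cvgB; [exact: cvg_cst|exact: cvg_id].
  exact: exprn_continuous.
have [Ky0 y0M] := set_mem y0B.
have ymin y : K y -> q y0 <= q y.
  move=> Ky; have [yM|yM] := leP `|y| M; first by apply: y0min; apply/mem_set.
  apply: (@le_trans _ _ (q 0)).
    by apply: y0min; apply/mem_set; split => //=; rewrite normr0 /M !addr_ge0.
  apply: le_trans (qge y).
  have h : 1 + q 0 <= `|x - y|.
    have : `|y| <= `|x| + `|x - y|.
      rewrite -{1}[y](subrK x) addrC; apply: le_trans (ler_normD _ _) _.
      by rewrite distrC.
    by move: yM; rewrite /M; lra.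
  nra.
have qE y t : q (y0 + t *: y) = q y0 - 2 * t * (\sum_i (x 0 i - y0 0 i) * y 0 i)
    + t ^+ 2 * \sum_i y 0 i ^+ 2.
  rewrite /q !mulr_sumr -sumrB -big_split /=; apply: eq_bigr => i _.
  by rewrite !mxE; ring.
(* First-order optimality of y0 along a feasible direction. *)
have opt y : (forall t, 0 <= t <= 1 -> K (y0 + t *: y)) ->
    \sum_i (x 0 i - y0 0 i) * y 0 i <= 0.
  move=> yP; rewrite leNgt; apply/negP.
  set s := \sum_i _ => s0; pose N := \sum_i y 0 i ^+ 2.
  have N0 : 0 <= N by apply: sumr_ge0 => i _; exact: sqr_ge0.
  (* This step satisfies [0 < t <= 1] and [t * N < s], so that [q] changes by
     [t * (t * N - 2 * s) < 0], against the minimality of [y0]. *)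
  pose t := s / (N + s + 1).
  have D0 : 0 < N + s + 1 by lra.
  have tD : t * (N + s + 1) = s by rewrite /t divfK// gt_eqF.
  have t0 : 0 < t by rewrite divr_gt0.
  have t1 : t <= 1 by rewrite ler_pdivrMr // mul1r; lra.
  have := ymin _ (yP t _); rewrite qE -/s -/N ltW //= => /(_ t1).
  have tN : t * N < s by rewrite -[ltRHS]tD; nra.
  nra.
exists (fun i => y0 0 i - x 0 i); split.
  move=> y Ky; have := opt y; rewrite -oppr_ge0 -sumrN.
  under eq_bigr => i _ do rewrite -mulNr opprB mulrC.
  by apply => t /andP[t0 _]; apply: KD => //; exact: KZ.
(* The direction [- y0] is feasible up to [t = 1], since [K] contains the segment from [y0] to 0. *)
have /opt h t : 0 <= t <= 1 -> K (y0 + t *: - y0).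
  by move=> /andP[t0 t1]; rewrite scalerN -{1}[y0]scale1r -scalerBl; apply: KZ; rewrite ?subr_ge0.
have qpos : 0 < q y0.
  rewrite lt_neqAle; apply/andP; split; last by apply: sumr_ge0 => i _; exact: sqr_ge0.
  apply/eqP => q0; apply: Kx; suff -> : x = y0 by [].
  have qxy := qge y0; rewrite -q0 in qxy.
  have : `|x - y0| ^+ 2 == 0 by rewrite eq_le qxy sqr_ge0.
  by rewrite expf_eq0 /= normr_eq0 subr_eq0 => /eqP.
suff -> : \sum_i x 0 i * (y0 0 i - x 0 i) =
    - q y0 + \sum_i (x 0 i - y0 0 i) * (- y0) 0 i by lra.
rewrite -sumrN -big_split /=; apply: eq_bigr => i _; rewrite !mxE; ring.
Qed.

Lemma scalar_sum (R : realType) (V : lmodType R) (phi : V -> R) (I : finType) (c : I -> R)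
    (v : I -> V) :
  scalar phi -> phi (\sum_i c i *: v i) = \sum_i c i * phi (v i).
Proof.
move=> phiL; pose f : {linear V -> R | *%R} :=
  HB.pack phi (GRing.isLinear.Build R V R *%R phi phiL).
rewrite -[phi]/(f : V -> R) linear_sum; apply: eq_bigr => i _.
by rewrite linearZ.
Qed.

(** * The inner product of tensors, symmetrization and polarization *)

Section TensorTheory.
Context {R : realType} {E : vectType R}.
Context (dot : {dot E for idfun}).
Notation n := (\dim {:E}).

(** The Gram matrix of the basis is invertible: a row vector in its left kernel is the coordinate
    vector of some x with [dot x x = 0]. The columns of the inverse are the coordinates of the dual
    basis. *)
Lemma dual_basis :
  exists d : 'I_n -> E, forall i j, dot (tbasis i) (d j) = (i == j)%:R.
Proof.
pose G : 'M[R]_n := \matrix_(i, j) dot (tbasis i) (tbasis j).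
have Gu : G \in unitmx.
  rewrite -row_free_unit -kermx_eq0; apply/eqP/row_matrixP => l; rewrite row0.
  set u := row l _.
  have uG : u *m G = 0 by rewrite -row_mul mulmx_ker row0.
  pose x : E := \sum_i u 0 i *: tbasis i.
  have x0 : x = 0.
    apply/eqP; apply: contraT => x0; have := @neq0_dnorm_gt0 _ _ _ dot x x0.
    suff -> : dot x x = 0 by rewrite ltxx.
    rewrite {2}/x linear_sumr big1// => j _; rewrite linearZr_LR /= /x linear_sumlz.
    under eq_bigr => i _ do rewrite linearZl_LR.
    have := congr1 (fun v : 'rV_n => v 0 j) uG; rewrite !mxE => h.
    by under eq_bigr => i _ do [rewrite /= (_ : dot _ _ = G i j); last by rewrite mxE];
      rewrite h mulr0.
  apply/rowP => i; rewrite [RHS]mxE.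
  have /(congr1 (coord (vbasis {:E}) i)) := x0.
  by rewrite linear0 /x (coord_sum_free (fun i => u 0 i) i (basis_free (vbasisP {:E}))).
exists (fun j => \sum_l invmx G l j *: (tbasis l : E)) => i j.
transitivity ((G *m invmx G) i j); last by rewrite mulmxV// mxE.
rewrite linear_sumr mxE; apply: eq_bigr => l _.
by rewrite linearZr_LR /= mxE mulrC.
Qed.

Lemma tdot_scalarl k (B : tensor E k) : scalar (fun A => tdot dot A B).
Proof.
move=> a A A'; rewrite /tdot mulr_sumr -big_split; apply: eq_bigr => i _ /=.
rewrite mulr_sumr -big_split; apply: eq_bigr => j _ /=.
by rewrite /tcoef !mxE; ring.
Qed.

Lemma tdotC k (A B : tensor E k) : tdot dot A B = tdot dot B A.
Proof.
rewrite /tdot exchange_big; apply: eq_bigr => j _; apply: eq_bigr => i _.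
rewrite [tcoef A i * _]mulrC; congr (_ * _).
by apply: eq_bigr => s _; rewrite hermC expr0 mul1r.
Qed.

Lemma tdot0l k (B : tensor E k) : tdot dot 0 B = 0.
Proof. by have := tdot_scalarl B (-1) 0 0; rewrite scaler0 addr0 => ->; ring. Qed.

Lemma tdot_scalarr k (A : tensor E k) : scalar (tdot dot A).
Proof. by move=> a B C; rewrite !(tdotC A); exact: tdot_scalarl. Qed.

Lemma tdot_tpurer k (A : tensor E k) (y : 'I_k -> E) :
  tdot dot A (tpure y) = \sum_i tcoef A i * \prod_s dot (tbasis (i s)) (y s).
Proof.
apply: eq_bigr => i _.
under [in RHS]eq_bigr => s _ do
  [rewrite [X in dot _ X](coord_vbasis (memvf _)) linear_sumr;
   under eq_bigr => l _ do rewrite linearZr_LR].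
rewrite bigA_distr_bigA mulr_sumr; apply: eq_bigr => l _.
by rewrite tcoefE -mulrA -big_split.
Qed.

(** Each summand carries a product of Kronecker deltas, which vanishes unless the two multi-indices
    agree. This supplies the nondegeneracy of [tdot] behind Riesz representation and
    polarization. *)
Lemma tdot_dual k (d : 'I_n -> E) :
  (forall i j, dot (tbasis i) (d j) = (i == j)%:R) ->
  forall (A : tensor E k) (j : tindex k),
    tdot dot A (tpure (fun s => d (j s))) = tcoef A j.
Proof.
move=> dP A j; rewrite tdot_tpurer.
rewrite (eq_bigr (fun i => tcoef A i * (i == j)%:R)) => [|i _]; last first.
  congr (_ * _); have [->|ij] := eqVneq i j; first by rewrite big1// => s _; rewrite dP eqxx.
  have /forallPn[s sP] : ~~ [forall s, i s == j s].
    by apply: contra ij => /forallP e; apply/eqP/ffunP => s; exact/eqP.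
  by rewrite (bigD1 s) //= dP (negbTE sP) mul0r.
rewrite (bigD1 j) //= eqxx mulr1 big1 ?addr0//.
by move=> i /negbTE ->; rewrite mulr0.
Qed.

Lemma tdot_riesz k (phi : tensor E k -> R) :
  scalar phi -> exists C, forall A, tdot dot A C = phi A.
Proof.
move=> phiL; have [d dP] := dual_basis.
exists (\sum_(j : 'I_#|tindex k|)
  phi (delta_mx 0 j) *: tpure (fun s => d ((enum_val j : tindex k) s))) => A.
rewrite (scalar_sum _ _ (tdot_scalarr A)).
rewrite [in RHS](row_sum_delta A) (scalar_sum _ _ phiL); apply: eq_bigr => j _.
by rewrite mulrC (tdot_dual dP) /tcoef enum_valK.
Qed.

Lemma tensor_permM k (s t : 'S_k) (A : tensor E k) :
  tensor_perm s (tensor_perm t A) = tensor_perm (t * s)%g A.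
Proof.
apply: tensorP => i; rewrite !tcoefE; congr tcoef; apply/ffunP => u.
by rewrite !ffunE permM.
Qed.

Lemma tcoef_scalar k (i : tindex k) : scalar (fun A : tensor E k => tcoef A i).
Proof. by move=> a A B; rewrite /tcoef !mxE. Qed.

Lemma tensor_perm_linear k (s : 'S_k) : linear (@tensor_perm R E k s).
Proof. by move=> a A B; apply: tensorP => i; rewrite tcoef_scalar !tcoefE tcoef_scalar. Qed.

HB.instance Definition _ k s := GRing.isLinear.Build R (tensor E k) (tensor E k)
  *:%R (@tensor_perm R E k s) (@tensor_perm_linear k s).

Lemma symmetrize_linear k : linear (@symmetrize R E k).
Proof.
move=> a A B; rewrite /symmetrize scalerA mulrC -scalerA -scalerDr; congr (_ *: _).
rewrite scaler_sumr -big_split /=; apply: eq_bigr => s _.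
exact: tensor_perm_linear.
Qed.

HB.instance Definition _ k := GRing.isLinear.Build R (tensor E k) (tensor E k)
  *:%R (@symmetrize R E k) (@symmetrize_linear k).

Lemma symmetrize_sym k (A : tensor E k) : symmetric_tensor k (symmetrize A).
Proof.
move=> s; rewrite /symmetrize linearZ linear_sum /=; congr (_ *: _).
under eq_bigr => t _ do rewrite tensor_permM.
by rewrite [RHS](reindex_inj (mulIg s)).
Qed.

Lemma tdot_perm k (s : 'S_k) (A B : tensor E k) :
  tdot dot (tensor_perm s A) (tensor_perm s B) = tdot dot A B.
Proof.
pose h (t : 'S_k) (i : @tindex R E k) : @tindex R E k := [ffun u => i (t u)].
have hK : cancel (h s) (h s^-1%g).
  by move=> i; apply/ffunP => u; rewrite !ffunE permKV.
rewrite [RHS](reindex_inj (can_inj hK)); apply: eq_bigr => i _.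
rewrite [RHS](reindex_inj (can_inj hK)); apply: eq_bigr => j _.
rewrite !tcoefE; congr (_ * _).
rewrite (reindex_inj (@perm_inj _ s)); apply: eq_bigr => u _.
by rewrite !ffunE.
Qed.

(** Permutations preserve [tdot] and fix [B], so all terms of the average have the same pairing with
    [B]. *)
Lemma tdot_symmetrize k (A B : tensor E k) :
  symmetric_tensor k B -> tdot dot (symmetrize A) B = tdot dot A B.
Proof.
move=> Bsym; have L := tdot_scalarl B.
rewrite /symmetrize scaler_sumr (scalar_sum _ _ L).
rewrite (eq_bigr (fun=> (k`!%:R)^-1 * tdot dot A B)) => [|s _]; last first.
  by rewrite -{1}(Bsym s) tdot_perm.
rewrite sumr_const card_Sn -[_ *+ k`!]mulr_natr mulrAC mulVf ?mul1r//.
Qed.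

Lemma symmetric_tpow k (x : E) : symmetric_tensor k (tpow k x).
Proof.
move=> s; apply: tensorP => i; rewrite !tcoefE [RHS](reindex_inj (@perm_inj _ s)).
by apply: eq_bigr => t _; rewrite ffunE.
Qed.

Lemma symmetric_lin k a (A B : tensor E k) :
  symmetric_tensor k A -> symmetric_tensor k B -> symmetric_tensor k (a *: A + B).
Proof. by move=> sA sB s; rewrite linearP /= sA sB. Qed.

Lemma symmetric0 k : symmetric_tensor k (0 : tensor E k).
Proof. by move=> s; rewrite linear0. Qed.

Lemma tensor_perm_tpure k (s : 'S_k) (x : 'I_k -> E) :
  tensor_perm s (tpure (fun t => x (s t))) = tpure x.
Proof.
apply: tensorP => i; rewrite !tcoefE [RHS](reindex_inj (@perm_inj _ s)).
by apply: eq_bigr => t _; rewrite ffunE.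
Qed.

Lemma tpow_sum k (I : finType) (c : I -> R) (x : I -> E) :
  tpow k (\sum_t c t *: x t) =
  \sum_(f : {ffun 'I_k -> I}) (\prod_s c (f s)) *: tpure (fun s => x (f s)).
Proof.
apply: tensorP => i; rewrite tcoefE.
under eq_bigr => s _ do
  [rewrite linear_sum; under eq_bigr => t _ do rewrite linearZ].
rewrite bigA_distr_bigA /tcoef summxE; apply: eq_bigr => f _.
by rewrite !mxE enum_rankK big_split.
Qed.

(* Polarization: averaging <A, (sum_t e_t x_t)^(⊗k)> against the product of the
   signs e_t leaves the terms in which every x_t occurs exactly once. *)
Lemma tdot_tpow_inj k (A : tensor E k) : symmetric_tensor k A ->
  (forall x, tdot dot A (tpow k x) = 0) -> A = 0.
Proof.
move=> Asym A0.
pose sg (e : {ffun 'I_k -> bool}) t : R := (-1) ^+ e t.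
have sgE (f : {ffun 'I_k -> 'I_k}) :
    \sum_e (\prod_s sg e s) * \prod_s sg e (f s) = (injectiveb f)%:R * 2 ^+ k.
  have [/injectiveP finj|fninj] := boolP (injectiveb f).
    rewrite mul1r (eq_bigr (fun=> 1)) => [|e _].
      by rewrite sumr_const card_ffun card_bool card_ord natrX.
    rewrite [X in X * _](reindex_inj finj) -big_split big1// => s _.
    by rewrite /sg /= -signr_addb addbb.
  (* A map that is not injective on a finite set misses some [t]. Flipping the sign at [t] negates
     the first product and leaves the second unchanged, so the sum equals its own negative. *)
  have [t tP] : exists t, forall s, f s != t.
    have : ~~ [forall t, [exists s, f s == t]].
      apply: contra fninj => /forallP fs; apply/injectiveP.
      have gP t := xchooseP (existsP (fs t)).
      pose g t := xchoose (existsP (fs t)).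
      have gK : cancel g f by move=> t; apply/eqP; exact: gP.
      exact: bij_inj (bij_can_bij (injF_bij (can_inj gK)) gK).
    by move=> /forallPn[t]; rewrite negb_exists => /forallP tP; exists t.
  rewrite mul0r.
  pose sw (e : {ffun 'I_k -> bool}) : {ffun 'I_k -> bool} :=
    [ffun s => if s == t then ~~ e s else e s].
  have swK : involutive sw.
    by move=> e; apply/ffunP => s; rewrite !ffunE; case: eqP => // _; exact: negbK.
  set S := \sum_e _; suff : S = - S by move=> h; lra.
  rewrite {1}/S (reindex_inj (inv_inj swK)) -sumrN; apply: eq_bigr => e _.
  rewrite -mulNr; congr (_ * _); last first.
    by apply: eq_bigr => s _; rewrite /sg ffunE (negbTE (tP s)).
  rewrite (bigD1 t) //= [in RHS](bigD1 t) //= -mulNr; congr (_ * _).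
    by rewrite /sg ffunE eqxx signrN.
  by apply: eq_bigr => s st; rewrite /sg ffunE (negbTE st).
have Apure (x : 'I_k -> E) : tdot dot A (tpure x) = 0.
  have L := tdot_scalarr A.
  have Af (f : {ffun 'I_k -> 'I_k}) : injective f ->
      tdot dot A (tpure (fun s => x (f s))) = tdot dot A (tpure x).
    move=> finj; rewrite -[in RHS](tensor_perm_tpure (perm finj)) -{2}(Asym (perm finj)).
    rewrite tdot_perm; congr (tdot _ _ (tpure _)).
    by apply/funext => s; rewrite permE.
  have : \sum_e (\prod_s sg e s) * tdot dot A (tpow k (\sum_t sg e t *: x t)) = 0.
    by rewrite big1// => e _; rewrite A0 mulr0.
  under eq_bigr => e _ do rewrite tpow_sum (scalar_sum _ _ L) mulr_sumr.
  rewrite exchange_big /=.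
  rewrite (eq_bigr (fun f : {ffun 'I_k -> 'I_k} =>
     (injectiveb f)%:R * (2 ^+ k * tdot dot A (tpure x)))) => [|f _]; last first.
    under eq_bigr => e _ do rewrite mulrA.
    rewrite -mulr_suml sgE -mulrA.
    case: (boolP (injectiveb f)) => [/injectiveP /Af -> //|_]; by rewrite !mul0r.
  (* The sum is now the number of injections times [2 ^+ k] times the wanted pairing; the identity
     map shows that this number is nonzero. *)
  rewrite -mulr_suml => /eqP; rewrite !mulf_eq0 expf_eq0 pnatr_eq0 andbF /=.
  case/orP => [|/eqP//]; rewrite psumr_eq0 => [/allP /(_ [ffun s => s])|f _]; last first.
    exact: ler0n.
  rewrite mem_index_enum => /(_ isT) /=.
  suff -> : injectiveb [ffun s : 'I_k => s] by rewrite oner_eq0.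
  by apply/injectiveP => s t; rewrite !ffunE.
have [d dP] := dual_basis.
by apply: tensorP => i; rewrite -(tdot_dual dP) Apure /tcoef mxE.
Qed.
End TensorTheory.

(** * Closedness of dual cones and the bipolar theorem *)

Lemma closed_linear_eq (R : realType) d (V : normedModType R)
    (f g : {linear 'rV[R]_d -> V}) : closed [set x | f x = g x].
Proof.
have -> : [set x | f x = g x] = (fun x => `|f x - g x|) @^-1` [set 0].
  apply/seteqP; split => x /= => [->|/eqP]; first by rewrite subrr normr0.
  by rewrite normr_eq0 subr_eq0 => /eqP.
apply: (@preimage_closed _ _ (fun x : 'rV[R]_d => `|f x - g x|)); last exact: closed_eq.
move=> x _; apply: (@continuous_comp _ _ _ (fun x : 'rV[R]_d => f x - g x) (fun y => `|y|)).
  exact: (cvgB (@row_linear_continuous _ _ _ f x) (@row_linear_continuous _ _ _ g x)).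
exact: norm_continuous.
Qed.

Lemma closed_scalar_ge0 (R : realType) d (phi : 'rV[R]_d -> R) :
  scalar phi -> closed [set x | 0 <= phi x].
Proof.
move=> phiL; pose f : {linear 'rV[R]_d -> R^o} :=
  HB.pack phi (GRing.isLinear.Build R 'rV[R]_d R^o *:%R phi phiL).
apply: (@preimage_closed _ _ phi [set y | 0 <= y]); last exact: closed_ge.
move=> x _; exact: (@row_linear_continuous R d R^o f x).
Qed.

Section DualCones.
Context {R : realType} {E : vectType R} (dot : {dot E for idfun}).

Lemma closed_symmetric_tensor k : closed (symmetric_tensor k : set (tensor E k)).
Proof.
have -> : symmetric_tensor k =
    \bigcap_(s in [set: 'S_k]) [set A : tensor E k | tensor_perm s A = A].
  by apply/seteqP; split => A /= h s; [move=> _; exact: h|exact: h].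
apply: closed_bigI => s _.
exact: (@closed_linear_eq R _ _ (@tensor_perm R E k s) idfun).
Qed.

Lemma closed_dual_cone k (K : set (tensor E k)) : closed (dual_cone dot K).
Proof.
have -> : dual_cone dot K = symmetric_tensor k `&`
    \bigcap_(B in K) [set A | 0 <= tdot dot A B].
  by apply/seteqP; split => A [].
apply: closedI; first exact: closed_symmetric_tensor.
apply: closed_bigI => B _; apply: closed_scalar_ge0; exact: tdot_scalarl.
Qed.

(** A point outside the closure is cut off by a linear functional. Symmetrizing its Riesz
    representative puts it in the dual cone and keeps its pairings with symmetric tensors.
    Conversely, the bidual is closed and contains [K]. *)
Lemma bipolar k (K : set (tensor E k)) :
  convex_cone K -> K `<=` symmetric_tensor k ->
  dual_cone dot (dual_cone dot K) = closure K.
Proof.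
move=> Kcone Ksym; apply/seteqP; split => [A [Asym AP]|].
  apply: contrapT => nA.
  have [u [uK uA]] := cone_separation (@closed_closure _ K)
    (closure_convex_cone Kcone) nA.
  pose phi (B : tensor E k) := \sum_i B 0 i * u i.
  have phiL : scalar phi.
    move=> a B C; rewrite /phi mulr_sumr -big_split; apply: eq_bigr => i _.
    by rewrite !mxE /= mulrDl mulrA.
  have [C CP] := tdot_riesz dot phiL.
  have CS B : symmetric_tensor k B -> tdot dot B (symmetrize C) = phi B.
    by move=> Bsym; rewrite tdotC tdot_symmetrize// tdotC CP.
  have := AP (symmetrize C); rewrite CS // leNgt uA => h.
  suff /h : dual_cone dot K (symmetrize C) by [].
  split; first exact: symmetrize_sym.
  move=> B KB; rewrite tdotC CS; [|exact: Ksym].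
  by apply: uK; exact: subset_closure.
have /closure_id -> := @closed_dual_cone k (dual_cone dot K).
apply: closureS => A KA; split; first exact: Ksym.
by move=> B [_ BP]; rewrite tdotC; exact: BP.
Qed.
End DualCones.

(** * Homogeneous forms on E given by tensors *)

Section Forms.
Context {R : realType} {E : vectType R} (dot : {dot E for idfun}).
Notation n := (\dim {:E}).

(** A multi-index of length k + l is a pair of multi-indices, and the product over its entries
    factors accordingly. *)
Lemma tdot_tmul k l (A : tensor E k) (B : tensor E l) (x : E) :
  tdot dot (tmul A B) (tpow _ x) = tdot dot A (tpow k x) * tdot dot B (tpow l x).
Proof.
pose cat (p : @tindex R E k * @tindex R E l) : @tindex R E (k + l) :=
  [ffun s : 'I_(k + l) => match fintype.split s with
    | inl t => (p.1 : {ffun 'I_k -> 'I_n}) t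
    | inr t => (p.2 : {ffun 'I_l -> 'I_n}) t end].
pose cut (i : @tindex R E (k + l)) : @tindex R E k * @tindex R E l :=
  ([ffun s => i (lshift l s)], [ffun s => i (rshift k s)]).
have cutK : cancel cut cat.
  move=> i; apply/ffunP => s; rewrite ffunE.
  by case: fintype.splitP => t /= st; rewrite ffunE; congr (i _); apply: val_inj.
have catK : cancel cat cut.
  move=> [p1 p2]; congr (_, _); apply/ffunP => s; rewrite !ffunE /=.
    by rewrite (unsplitK (inl s)).
  by rewrite (unsplitK (inr s)).
rewrite !tdot_tpurer mulr_suml.
under [RHS]eq_bigr => i _ do rewrite mulr_sumr.
rewrite pair_big /= (reindex cat); last by exists cut => i _; [exact: catK|exact: cutK].
apply: eq_bigr => -[p1 p2] _ /=; rewrite tcoefE big_split_ord /=.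
have := catK (p1, p2); rewrite /cut => -[-> ->].
rewrite mulrACA; congr (_ * _ * (_ * _)); apply: eq_bigr => s _; rewrite ffunE /=.
  by rewrite (unsplitK (inl s)).
by rewrite (unsplitK (inr s)).
Qed.

(** The tensor is arbitrary, so that products of forms are immediate through [tmul]; [is_form_sym]
    symmetrizes at the end. *)
Definition is_form d (f : E -> R) :=
  exists A : tensor E d, forall x, f x = tdot dot A (tpow d x).

Lemma is_form_sym d f : is_form d f -> exists A : tensor E d,
  symmetric_tensor d A /\ forall x, f x = tdot dot A (tpow d x).
Proof.
move=> [A AP]; exists (symmetrize A); split; first exact: symmetrize_sym.
by move=> x; rewrite tdot_symmetrize//; exact: symmetric_tpow.
Qed.

Lemma is_form1 : is_form 0 (fun=> 1).
Proof.
exists (tpure (fun=> 0)) => x; rewrite tdot_tpure; apply/esym/big1 => -[s].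
by rewrite ltn0.
Qed.

Lemma is_formM d e f g : is_form d f -> is_form e g ->
  is_form (d + e) (fun x => f x * g x).
Proof.
by move=> [A fE] [B gE]; exists (tmul A B) => x; rewrite fE gE tdot_tmul.
Qed.

Lemma is_form_lincomb d (I : finType) (c : I -> R) (f : I -> E -> R) :
  (forall i, is_form d (f i)) -> is_form d (fun x => \sum_i c i * f i x).
Proof.
move=> /choice[A fE]; exists (\sum_i c i *: A i) => x.
rewrite (scalar_sum _ _ (tdot_scalarl dot _)); apply: eq_bigr => i _.
by rewrite fE.
Qed.

Lemma is_form_prod d e (f : 'I_d -> E -> R) :
  (forall s, is_form e (f s)) -> is_form (d * e) (fun x => \prod_s f s x).
Proof.
elim: d f => [|d IHd] f fP.
  by have [A AE] := is_form1; exists A => x; rewrite big_ord0 (AE x).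
have [A AE] := is_formM (fP ord0) (IHd (fun s => f (lift ord0 s)) (fun s => fP _)).
by exists A => x; rewrite big_ord_recl AE.
Qed.

Lemma is_form_coord i : is_form 1 (coord (vbasis {:E}) i).
Proof.
have [A AP] := tdot_riesz dot (@tcoef_scalar R E 1 [ffun=> i]).
exists A => x; rewrite tdotC AP tcoefE big_ord_recl big_ord0 mulr1.
by rewrite ffunE.
Qed.

(** In coordinates, [beta x x] is a linear combination of products of two coordinate forms. *)
Lemma is_form_bilinear (beta : E -> E -> R) :
  (forall y, scalar (beta^~ y)) -> (forall x, scalar (beta x)) ->
  is_form 2 (fun x => beta x x).
Proof.
move=> betal betar; pose c i (x : E) := coord (vbasis {:E}) i x.
have [A AE] : is_form 2 (fun x => \sum_(p : 'I_n * 'I_n)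
    beta (tbasis p.1) (tbasis p.2) * (c p.1 x * c p.2 x)).
  by apply: is_form_lincomb => p; apply: (@is_formM 1 1); exact: is_form_coord.
exists A => x; rewrite -AE -(pair_bigA _ (fun i j =>
  beta (tbasis i) (tbasis j) * (c i x * c j x))) /=.
have xE : x = \sum_i c i x *: tbasis i by exact: coord_vbasis (memvf x).
rewrite {1}xE (scalar_sum _ _ (betal x)); apply: eq_bigr => i _.
rewrite {2}xE (scalar_sum _ _ (betar (tbasis i))) mulr_sumr.
by apply: eq_bigr => j _ /=; ring.
Qed.

(** An expansion into monomials, in which a quadratic map such as the Jordan square can be
    substituted coordinate by coordinate. *)
Lemma tdot_tpow_coef k (A : tensor E k) : exists c : @tindex R E k -> R,
  forall x, tdot dot A (tpow k x) =
    \sum_i c i * \prod_s coord (vbasis {:E}) (i s) x.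
Proof.
exists (fun i => tdot dot A (delta_mx 0 (enum_rank i))) => x.
rewrite {1}(row_sum_delta (tpow k x)) (scalar_sum _ _ (tdot_scalarr dot A)).
rewrite (reindex enum_rank) /=; last exact/onW_bij/enum_rank_bij.
by apply: eq_bigr => i _; rewrite mulrC; congr (_ * _); exact: tcoefE.
Qed.

Lemma tdot_tpow_eq k (A B : tensor E k) :
  symmetric_tensor k A -> symmetric_tensor k B ->
  (forall x, tdot dot A (tpow k x) = tdot dot B (tpow k x)) -> A = B.
Proof.
move=> As Bs AB; apply/eqP; rewrite -subr_eq0 -scaleN1r addrC; apply/eqP.
apply: (@tdot_tpow_inj _ _ dot); first exact: (symmetric_lin (-1) Bs As).
by move=> x; rewrite tdot_scalarl AB; ring.
Qed.

End Forms.

(** * Existence and linearity of the lift and of its adjoint *)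

Section Lift.
Context {R : realType} {E : vectType R} (J : euclidean_jordan E).

(** Existence: [jdot J x x] and every coordinate of [jmul J x x] are quadratic forms, so the left
    side is a form, and symmetrizing a tensor that represents it gives the lift. *)
Lemma lift_tensorP r m (A : tensor E m) :
  symmetric_tensor _ (lift_tensor J r A) /\
  forall x, jdot J x x ^+ r * tdot (jdot J) A (tpow m (jmul J x x)) =
    tdot (jdot J) (lift_tensor J r A) (tpow _ x).
Proof.
apply: (@xgetPex _ 0 [set B | symmetric_tensor _ B /\ forall x : E,
  jdot J x x ^+ r * tdot (jdot J) A (tpow m (jmul J x x)) =
  tdot (jdot J) B (tpow _ x)]).
apply: is_form_sym.
(* The order becomes [r * 2 + m * 2], the shape produced by multiplying r and m quadratic forms. *)
rewrite addnn -muln2 mulnDl.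
have [c cE] := tdot_tpow_coef (jdot J) A.
have dotr : is_form (jdot J) (r * 2) (fun x => \prod_(s < r) jdot J x x).
  apply: (@is_form_prod _ _ _ r 2) => _; apply: is_form_bilinear => z a x y.
    by rewrite linearPl.
  by rewrite linearP.
have mulm : is_form (jdot J) (m * 2) (fun x => tdot (jdot J) A (tpow m (jmul J x x))).
  have [B BE] : is_form (jdot J) (m * 2)
      (fun x => \sum_i c i * \prod_s coord (vbasis {:E}) (i s) (jmul J x x)).
    apply: is_form_lincomb => i; apply: is_form_prod => s.
    apply: (@is_form_bilinear _ _ (jdot J)
      (fun x y => coord (vbasis {:E}) (i s) (jmul J x y))) => z a x y.
      by rewrite linearPl /= linearP.
    by rewrite linearP /= linearP.
  by exists B => x; rewrite -BE cE.
have [B BE] := is_formM dotr mulm.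
by exists B => x; rewrite -BE prodr_const card_ord.
Qed.

(** Both sides are symmetric and represent the same form, so polarization identifies them. *)
Lemma lift_tensor_linear r m : linear (@lift_tensor R E J r m).
Proof.
move=> a A B; have [As AE] := lift_tensorP r A; have [Bs BE] := lift_tensorP r B.
have [Cs CE] := lift_tensorP r (a *: A + B).
apply: (tdot_tpow_eq (dot := jdot J) Cs (symmetric_lin a As Bs)) => x.
by rewrite tdot_scalarl -AE -BE -CE tdot_scalarl; ring.
Qed.

(** The Riesz representative of the functional is symmetrized, which keeps its pairings with
    symmetric [A]. *)
Lemma lift_adjointP r m (X : tensor E ((r + m) + (r + m))%N) :
  symmetric_tensor m (lift_adjoint J X) /\
  forall A, symmetric_tensor m A ->
    tdot (jdot J) A (lift_adjoint J X) = tdot (jdot J) (lift_tensor J r A) X.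
Proof.
apply: (@xgetPex _ 0 [set C | symmetric_tensor m C /\
    forall A, symmetric_tensor m A ->
      tdot (jdot J) A C = tdot (jdot J) (lift_tensor J r A) X]).
have [|C CP] := @tdot_riesz _ _ (jdot J) _
  (fun A => tdot (jdot J) (lift_tensor J r A) X).
  by move=> a A B; rewrite lift_tensor_linear tdot_scalarl.
exists (symmetrize C); split; first exact: symmetrize_sym.
by move=> A Asym; rewrite tdotC tdot_symmetrize// tdotC CP.
Qed.

Lemma lift_adjoint_linear r m :
  linear (@lift_adjoint R E J r m).
Proof.
move=> a X Y; have [Xs XE] := lift_adjointP X; have [Ys YE] := lift_adjointP Y.
have [Zs ZE] := lift_adjointP (a *: X + Y).
apply: (tdot_tpow_eq (dot := jdot J) Zs (symmetric_lin a Xs Ys)) => x.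
have xs := @symmetric_tpow _ _ m x.
by rewrite !(tdotC _ _ (tpow m x)) tdot_scalarr XE// YE// ZE// tdot_scalarr.
Qed.

End Lift.

(** * Positive semidefinite matrices as sums of squares *)

(* Symmetric Gaussian elimination with pivots M i i; a zero pivot forces the
   whole i-th row to vanish. *)
Lemma psd_sum_squares (R : rcfType) d (P : 'rV[R]_d -> Prop) (M : 'M[R]_d) :
  P 0 -> (forall a u v, P u -> P v -> P (a *: u + v)) ->
  M^T = M -> (forall w : 'rV_d, 0 <= (w *m M *m w^T) 0 0) ->
  (forall i, P (row i M)) ->
  exists s : seq 'rV[R]_d,
    {in s, forall B, P B} /\ M = \sum_(B <- s) B^T *m B.
Proof.
(* Induction on a bound for the number of nonzero diagonal entries, which each elimination step
   lowers. *)
move=> P0 PL; have [c] := ubnP #|[set i | M i i != 0]%SET|.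
elim: c M => // c IHc M /ltnSE Mc Msym Mpsd MP.
pose f (u v : 'rV[R]_d) := (u *m M *m v^T) 0 0.
have fC u v : f u v = f v u.
  have -> : f u v = (u *m M *m v^T)^T 0 0 by rewrite [RHS]mxE.
  by rewrite !trmx_mul trmxK Msym mulmxA.
have fE t u v : f (t *: u + v) (t *: u + v) = t ^+ 2 * f u u + 2 * t * f u v + f v v.
  rewrite [f u v in RHS](_ : _ = (f u v + f v u) / 2); last by rewrite -fC; field.
  rewrite /f linearP /= !mulmxDl !mulmxDr -!scalemxAl -!scalemxAr !mxE.
  by field.
pose e i : 'rV[R]_d := delta_mx 0 i.
have fe i v : f (e i) v = \sum_j M i j * v 0 j.
  rewrite /f -rowE mxE; apply: eq_bigr => j _; by rewrite !mxE.
have fee i j : f (e i) (e j) = M i j.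
  rewrite fe (bigD1 j) //= mxE !eqxx mulr1 big1 ?addr0// => l /negbTE lj.
  by rewrite mxE lj mulr0.
have M0 i j : M i i = 0 -> M i j = 0.
  move=> Mii; apply/eqP; apply: contraT => Mij.
  (* Chosen so that the quadratic form takes the value -1 at [t *: e i + e j]. *)
  pose t := - (M j j + 1) / (2 * M i j).
  have tE : 2 * t * M i j = - (M j j + 1) by rewrite /t; field.
  have : 0 <= f (t *: e i + e j) (t *: e i + e j) by exact: Mpsd.
  by rewrite fE !fee Mii mulr0 add0r tE; lra.
have [i Mii|D0] := pickP [pred i | M i i != 0]; last first.
  exists [::]; split => //; rewrite big_nil; apply/matrixP => i j; rewrite [RHS]mxE M0//.
  by apply/eqP; have := D0 i; rewrite /= => /negbFE.
rewrite /= in Mii.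
have Mi_gt0 : 0 < M i i by rewrite lt_neqAle eq_sym Mii -fee; exact: Mpsd.
pose N := M - (M i i)^-1 *: ((row i M)^T *m row i M).
have NE j l : N j l = M j l - (M i i)^-1 * (M i j * M i l).
  by rewrite !mxE big_ord_recl big_ord0 addr0 !mxE.
have Msw j l : M j l = M l j by rewrite -{1}Msym mxE.
have [||||s [sP NsE]] := IHc N.
- apply: leq_trans Mc; apply/proper_card/properP; split.
    apply/fintype.subsetP => j; rewrite !inE NE; apply: contra => /eqP Mjj.
    by rewrite (Msw i j) Mjj (M0 j i Mjj) !mulr0 subr0.
  by exists i; rewrite !inE // NE mulKf// subrr eqxx.
- by apply/matrixP => j l; rewrite mxE !NE Msw [M i l * _]mulrC.
- move=> w.
  (* Completing the square: the Schur complement [N] takes at w the value of [M] at w shifted along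
     [e i] to its minimum. *)
  suff -> : (w *m N *m w^T) 0 0 =
      f ((- (f (e i) w / M i i)) *: e i + w) ((- (f (e i) w / M i i)) *: e i + w).
    exact: Mpsd.
  rewrite fE fee /N mulmxBr mulmxBl -scalemxAr -scalemxAl.
  rewrite mxE [X in _ + X]mxE [X in _ - X]mxE -/(f w w).
  have -> : (w *m ((row i M)^T *m row i M) *m w^T) 0 0 = f (e i) w ^+ 2.
    rewrite mulmxA -mulmxA mxE big_ord_recl big_ord0 addr0 expr2.
    congr (_ * _); last by rewrite /f -rowE.
    by rewrite /f -rowE -[in RHS](trmxK (row i M)) -trmx_mul [RHS]mxE.
  by field.
- move=> j; rewrite (_ : row j N = (- ((M i i)^-1 * M i j)) *: row i M + row j M).
    exact: PL.
  by apply/rowP => l; rewrite mxE NE !mxE; ring.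
exists (((Num.sqrt (M i i))^-1 *: row i M) :: s); split.
  move=> B; rewrite inE => /orP[/eqP->|/sP//].
  by rewrite -[_ *: _]addr0; exact: PL.
rewrite big_cons -NsE; set v := row i M; set a := (Num.sqrt _)^-1.
have -> : (a *: v)^T *m (a *: v) = a ^+ 2 *: (v^T *m v).
  by rewrite [(a *: v)^T]linearZ /= -scalemxAl -scalemxAr scalerA.
by rewrite /a exprVn sqr_sqrtr ?ltW// addrC subrK.
Qed.

(** * Convex hulls that are cones *)

Lemma conv_hullS (R : realType) (V : lmodType R) (A : set V) : A `<=` conv_hull A.
Proof. by move=> x Ax C [_]; apply. Qed.

Lemma conv_hull_min (R : realType) (V : lmodType R) (A C : set V) :
  convex_set C -> A `<=` C -> conv_hull A `<=` C.
Proof. by move=> Cc AC x; apply. Qed.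

Lemma convex_conv_hull (R : realType) (V : lmodType R) (A : set V) :
  @convex_set R V (conv_hull A).
Proof.
move=> x y t /set_mem xA /set_mem yA; apply/mem_set => C [Cc AC].
by apply/set_mem/Cc; apply/mem_set; [exact: xA|exact: yA].
Qed.

Lemma convex_cone_convex (R : realType) (V : lmodType R) (K : set V) :
  convex_cone K -> convex_set K.
Proof.
move=> [_ KD KZ] x y t /set_mem Kx /set_mem Ky; apply/mem_set.
rewrite -[conv t x y]/(t%:num *: (x : V) + (1 - t%:num) *: (y : V)).
by apply: KD; apply: KZ => //; rewrite subr_ge0.
Qed.

Lemma convex_cone_conv_hull (R : realType) (V : lmodType R) (A : set V) :
  A 0 -> (forall a x, 0 <= a -> A x -> A (a *: x)) -> convex_cone (conv_hull A).
Proof.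
move=> A0 AZ.
have HZ a x : 0 <= a -> conv_hull A x -> conv_hull A (a *: x).
  move=> a0; apply: (@conv_hull_min _ _ _ [set x | conv_hull A (a *: x)]).
    move=> u v t /set_mem /= Au /set_mem /= Av; apply/mem_set => /=.
    rewrite -[conv t u v]/(t%:num *: (u : V) + (1 - t%:num) *: (v : V)).
    rewrite scalerDr !scalerA ![a * _]mulrC -!scalerA.
    have := @convex_conv_hull _ _ A (a *: (u : V)) (a *: (v : V)) t.
    by move=> /(_ (mem_set Au) (mem_set Av)) /set_mem.
  by move=> y Ay; apply: conv_hullS; exact: AZ.
split => // [|x y Ax Ay]; first exact: conv_hullS.
have h01 : (0 <= (2^-1 : R)) && ((2^-1 : R) <= 1) by apply/andP; split; lra.
(* A sum is twice a midpoint, so convexity and scaling give additivity. *)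
have -> : x + y = 2 *: (2^-1 *: x + (1 - 2^-1) *: y).
  rewrite scalerDr !scalerA mulfV// (_ : 2 * (1 - 2^-1) = 1 :> R) ?scale1r//.
  by field.
apply: HZ => //.
have [h0 h1] := andP h01.
have := @convex_conv_hull _ _ A x y (Itv01 h0 h1).
by move=> /(_ (mem_set Ax) (mem_set Ay)) /set_mem.
Qed.

Lemma convex_cone_image (R : numDomainType) (V W : lmodType R) (f : V -> W)
    (K : set V) : linear f -> convex_cone K -> convex_cone (f @` K).
Proof.
move=> fL [K0 KD KZ]; pose g : {linear V -> W} :=
  HB.pack f (GRing.isLinear.Build R V W *:%R f fL).
split; first by exists 0 => //; exact: (linear0 g).
- move=> _ _ [x Kx <-] [y Ky <-]; exists (x + y); first exact: KD.
  exact: (linearD g).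
- by move=> a _ a0 [x Kx <-]; exists (a *: x); [exact: KZ|exact: (linearZ_LR g)].
Qed.

(** * Gram matrices and the closedness of the cone of sums of squares *)

Section SumsOfSquares.
Context {R : realType} {E : vectType R} (dot : {dot E for idfun}) (k : nat).
Notation d := #|@tindex R E k|.

(** The identification of matrices with products of two tensors of order k, under which [B^T *m B]
    becomes [tmul B B]. *)
Definition tensor_of_gram (M : 'M[R]_d) : tensor E (k + k)%N :=
  tensor_of (fun i => M (enum_rank [ffun s => i (lshift k s)])
                        (enum_rank [ffun s => i (rshift k s)])).

Lemma tensor_of_gram_linear : linear tensor_of_gram.
Proof.
move=> a M N; apply: tensorP => i; rewrite tcoef_scalar !tcoefE.
by rewrite !mxE.
Qed.

HB.instance Definition _ := GRing.isLinear.Build R 'M[R]_d (tensor E (k + k)%N)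
  *:%R tensor_of_gram tensor_of_gram_linear.

Lemma tensor_of_gram_square (B : tensor E k) : tensor_of_gram (B^T *m B) = tmul B B.
Proof.
by apply: tensorP => i; rewrite !tcoefE mxE big_ord_recl big_ord0 addr0 mxE.
Qed.

Lemma tensor_of_gram_squares (s : seq (tensor E k)) :
  tensor_of_gram (\sum_(B <- s) B^T *m B) = \sum_(B <- s) tmul B B.
Proof.
by rewrite linear_sum; apply: eq_bigr => B _; exact: tensor_of_gram_square.
Qed.

(** The matrices are flattened to row vectors in order to apply [closed_cone_image]. The condition
    on the rows makes the squares found by elimination squares of symmetric tensors. *)
Definition gram_cone : set 'rV[R]_(d * d) :=
  [set v | [/\ (vec_mx v)^T = vec_mx v,
    forall i, symmetric_tensor k (row i (vec_mx v)) &
    forall w : 'rV_d, 0 <= (w *m vec_mx v *m w^T) 0 0]].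

Lemma closed_gram_cone : closed gram_cone.
Proof.
have -> : gram_cone = [set v | (trmx \o vec_mx) v = vec_mx v] `&`
    (\bigcap_(i in [set: 'I_d]) (\bigcap_(s in [set: 'S_k])
      [set v | (@tensor_perm R E k s \o row i \o vec_mx) v = (row i \o vec_mx) v])) `&`
    (\bigcap_(w in [set: 'rV[R]_d]) [set v | 0 <= (w *m vec_mx v *m w^T) 0 0]).
  apply/seteqP; split => v /=.
    by move=> [vT vs v0]; split; [split => // i _ s _; exact: vs|move=> w _; exact: v0].
  by move=> [[vT vs] v0]; split => // [i s|w]; [exact: vs|exact: v0].
apply: closedI; first apply: closedI.
- exact: closed_linear_eq.
- by apply: closed_bigI => i _; apply: closed_bigI => s _; exact: closed_linear_eq.
- apply: closed_bigI => w _; apply: closed_scalar_ge0 => a u v.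
  by rewrite linearP /= mulmxDr mulmxDl -scalemxAr -scalemxAl !mxE.
Qed.

Lemma convex_cone_gram_cone : convex_cone gram_cone.
Proof.
split.
- split; rewrite linear0; first by rewrite trmx0.
    by move=> i; rewrite row0; exact: symmetric0.
  by move=> w; rewrite mulmx0 mul0mx mxE.
- move=> u v [uT us u0] [vT vs v0]; split; rewrite linearD /=.
  + by rewrite linearD /= uT vT.
  + move=> i; rewrite linearD /= -[row i (vec_mx u)]scale1r.
    by apply: symmetric_lin; [exact: us|exact: vs].
  + by move=> w; rewrite mulmxDr mulmxDl mxE addr_ge0.
- move=> a u a0 [uT us u0]; split; rewrite linearZ /=.
  + by rewrite linearZ /= uT.
  + move=> i; rewrite linearZ /= -[_ *: _]addr0.
    by apply: symmetric_lin; [exact: us|exact: symmetric0].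
  + by move=> w; rewrite -scalemxAr -scalemxAl mxE mulr_ge0.
Qed.

Lemma gram_cone_squares v : gram_cone v ->
  exists s : seq (tensor E k), {in s, forall B, symmetric_tensor k B} /\
    vec_mx v = \sum_(B <- s) B^T *m B.
Proof.
move=> [vT vs v0].
apply: (psd_sum_squares (@symmetric0 R E k) _ vT v0 vs) => a A B.
exact: symmetric_lin.
Qed.

Lemma convex_cone_SOS : convex_cone (SOS E k).
Proof.
apply: convex_cone_conv_hull.
  exists 0; first exact: symmetric0.
  rewrite -tensor_of_gram_square mulmx0 !linear0 //.
move=> a _ a0 [B Bs <-]; exists (Num.sqrt a *: B).
  rewrite -[_ *: _]addr0; apply: symmetric_lin => //; exact: symmetric0.
rewrite -!tensor_of_gram_square [(Num.sqrt a *: B)^T]linearZ /=.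
rewrite -scalemxAl -scalemxAr scalerA -expr2 sqr_sqrtr//.
exact: (linearZ_LR (@symmetrize R E _ \o tensor_of_gram)).
Qed.

(** A single square comes from a rank-one Gram matrix, and the image of the cone is convex. In the
    other direction, elimination splits a Gram matrix into squares of symmetric tensors. *)
Lemma SOS_gram_cone :
  SOS E k =
    (@symmetrize R E (k + k) \o tensor_of_gram \o vec_mx) @` gram_cone.
Proof.
apply/seteqP; split.
  apply: conv_hull_min.
    apply/convex_cone_convex/convex_cone_image; last exact: convex_cone_gram_cone.
    by move=> a u v; rewrite linearP.
  move=> _ [B Bs <-]; exists (mxvec (B^T *m B)) => /=; last first.
    by rewrite mxvecK tensor_of_gram_square.
  split; rewrite mxvecK.
  - by rewrite trmx_mul trmxK.
  - move=> i; suff -> : row i (B^T *m B) = B 0 i *: B + 0.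
      by apply: symmetric_lin => //; exact: symmetric0.
    by apply/rowP => j; rewrite !mxE big_ord_recl big_ord0 !addr0 mxE.
  - move=> w; rewrite mulmxA -mulmxA mxE big_ord_recl big_ord0 addr0.
    have -> : (B *m w^T) 0 0 = (w *m B^T) 0 0.
      by rewrite -[B in LHS]trmxK -trmx_mul mxE.
    by rewrite -expr2 sqr_ge0.
move=> _ [v Kv <-] /=; have [s [sP ->]] := gram_cone_squares Kv; rewrite tensor_of_gram_squares.
have [S0 SD SZ] := convex_cone_SOS.
rewrite linear_sum big_seq; apply: (big_ind (SOS E k)) => // B Bs.
by apply: conv_hullS; exists B => //; exact: sP.
Qed.

Lemma closed_SOS : closed (SOS E k).
Proof.
rewrite SOS_gram_cone; apply: closed_cone_image.
- exact: closed_gram_cone.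
- exact: convex_cone_gram_cone.
move=> v Kv /= v0; have [s [sP sE]] := gram_cone_squares Kv.
have B0 B : B \in s -> B = 0.
  move=> Bs; apply: (@tdot_tpow_inj _ _ dot); first exact: sP.
  move=> x.
  have : tdot dot (symmetrize (tensor_of_gram (vec_mx v))) (tpow _ x) = 0.
    by rewrite v0 tdot0l.
  (* Pairing with a symmetric power removes the symmetrization and leaves a sum of squares of real
     numbers. *)
  rewrite tdot_symmetrize; last exact: symmetric_tpow.
  rewrite sE tensor_of_gram_squares.
  have -> : tdot dot (\sum_(B <- s) tmul B B) (tpow _ x) =
      \sum_(B <- s) tdot dot B (tpow k x) ^+ 2.
    rewrite big_tnth [RHS]big_tnth.
    under eq_bigr => i _ do rewrite -[tmul _ _]scale1r.
    rewrite (scalar_sum _ _ (tdot_scalarl dot _)); apply: eq_bigr => i _.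
    by rewrite mul1r tdot_tmul.
  move=> /eqP; rewrite psumr_eq0 => [/allP /(_ _ Bs)|C _]; last exact: sqr_ge0.
  by rewrite /= sqrf_eq0 => /eqP.
rewrite -[v]vec_mxK sE big_seq big1 ?linear0// => B /B0 ->.
exact: mulmx0.
Qed.
End SumsOfSquares.

(** * The two dualities *)

Lemma convex_cone_dual_cone (R : realType) (E : vectType R)
    (dot : {dot E for idfun}) k (K : set (tensor E k)) :
  convex_cone (dual_cone dot K).
Proof.
split.
- by split=> [|B _]; [exact: symmetric0|rewrite tdot0l].
- move=> A B [As A0] [Bs B0]; rewrite -[A]scale1r; split.
    exact: symmetric_lin.
  by move=> C KC; rewrite tdot_scalarl mul1r addr_ge0 ?A0 ?B0.
- move=> a A a0 [As A0]; rewrite -[_ *: _]addr0; split.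
    by apply: symmetric_lin => //; exact: symmetric0.
  by move=> C KC; rewrite tdot_scalarl tdot0l addr0 mulr_ge0 ?A0.
Qed.

Lemma SOS_symmetric (R : realType) (E : vectType R) k :
  SOS E k `<=` symmetric_tensor (k + k)%N.
Proof.
by rewrite SOS_gram_cone => _ [v _ <-]; exact: symmetrize_sym.
Qed.

Theorem proposition3p6 (R : realType) (E : vectType R)
    (J : euclidean_jordan E) (m r : nat) (hm : (1 <= m)%N) :
  K_NN J r m = dual_cone (jdot J) (C_cone J r m) /\
  dual_cone (jdot J) (K_NN J r m) = closure (C_cone J r m).
Proof.
have KC : K_NN J r m = dual_cone (jdot J) (C_cone J r m).
  apply/seteqP; split => A [As].
    (* Adjointness turns the pairing into that of a sum of squares with a moment tensor. *)
    move=> SA; split => // _ [X [Xs XS] <-].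
    by rewrite (lift_adjointP J X).2// tdotC; exact: XS.
  move=> AC; split => //.
  (* As [SOS] is closed, membership may be tested in its bidual, that is, against all moment
     tensors. *)
  have /closure_id -> := @closed_SOS _ _ (jdot J) (r + m).
  rewrite -(bipolar (jdot J) (convex_cone_SOS _) (@SOS_symmetric _ _ _)).
  split; first exact: (lift_tensorP J r A).1.
  move=> X MX; rewrite -(lift_adjointP J X).2//.
  by apply: AC; exists X.
(* By the first equality the left side is the bidual of [C_cone], a convex cone as the linear image
   of the dual cone [MOM]. *)
split => //; rewrite KC; apply: bipolar.
  apply: convex_cone_image; first exact: lift_adjoint_linear.
  exact: convex_cone_dual_cone.
by move=> _ [X _ <-]; exact: (lift_adjointP J X).1.
Qed.
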